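(* Let $(G,+)$ be a commutative inverse semigroup containing at least two idempotents. If $\mathrm{End}(G)$ is separated by idempotents, then $\mathrm{End}(G)$ is subdirectly irreducible and its monolith is $\mathscr{R}=\mathscr{R}_I\cap\mathscr{R}_L$.
   Context: An inverse semigroup is a semigroup in which each element $s$ has a unique inverse $s'$; additively, $s+s'+s=s$ and $s'+s+s'=s'$. $E(G)$ denotes the set of idempotents of $G$. A semiring is a set with two associative operations $+,\cdot$ such that $\cdot$ distributes over $+$ on both sides (no zero or identity is required). For a commutative inverse semigroup $(G,+)$, $\mathrm{End}(G)$ is the semiring of all semigroup endomorphisms of $G$, with pointwise addition and with composition $(f\cdot g)(x)=f(g(x))$ as multiplication. For $a,b\in G$ write $a\leq_q b$ if and only if $a+a'+b=b$ (a quasi-order on $G$). For $a\in G$, $\lambda_a\in \mathrm{End}(G)$ is the constant map $\lambda_a(x)=a+a'$ for all $x\in G$. A nonempty subset $A\subseteq \mathrm{End}(G)$ with at least two elements is separated by idempotents if for any $f,g\in A$ with $f\neq g$ there exists $e\in E(G)$ with $f(e)\neq g(e)$. Relations on $\mathrm{End}(G)$: $f\,\mathscr{R}_I\,g$ if and only if $f+\lambda_a=g+\lambda_a$ for some $a\in G$. $f\,\mathscr{R}_L\,g$ if and only if both of the following hold: (i) the range of $f$ is a lower bounded subset of $G$, i.e. there exists $a\in G$ such that $a\leq_q f(x)$ for all $x\in G$; (ii) the range of $g$ is a lower bounded subset of $G$, i.e. there exists $b\in G$ such that $b\leq_q g(x)$ for all $x\in G$. A semiring is subdirectly irreducible if it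 has at least two elements and among its non-identity (semiring) congruences there is a least one; this least non-identity congruence is called its monolith.
   Formalization: The monolith is R_I ∩ R_L together with the equality relation; as printed R_I ∩ R_L need not be reflexive (e.g. at the identity map of (ℕ, min)), so it is not always a congruence. The two agree whenever G has a lower bound. *)

(* Defs.v *)
From HB Require Import structures.
From Stdlib Require Import Relation_Operators RelationClasses.
From mathcomp Require Import all_boot.
From mathcomp Require Import boolp classical_sets.

Set Implicit Arguments.
Unset Strict Implicit.
Unset Printing Implicit Defensive.

Local Open Scope ring_scope.
Local Open Scope classical_set_scope.

(* The inverse [pinv x] is what is written x' on paper; [addSemigroupType]
   already provides a commutative associative addition, without a zero. *)
HB.mixin Record AddSemigroup_isInverse G of Algebra.AddSemigroup G := {
  pinv : G -> G;
  addr_pinvK : forall x : G, x + pinv x + x = x;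
  pinv_addrK : forall x : G, pinv x + x + pinv x = pinv x;
  pinv_unique : forall x y : G, x + y + x = x -> y + x + y = y -> y = pinv x
}.

#[short(type="comInvSemigroupType")]
HB.structure Definition ComInvSemigroup :=
  {G of AddSemigroup_isInverse G & Algebra.AddSemigroup G}.

(* Semirings with neither a zero nor an identity; addition is only required to
   be associative.  The multiplication is the one of [magmaType], written in
   [group_scope]. *)
HB.mixin Record isBareSemiring S of Algebra.BaseAddMagma S & Magma S := {
  bare_addA : associative (@Algebra.add S);
  bare_mulA : associative (@mul S);
  bare_mulDl : left_distributive (@mul S) (@Algebra.add S);
  bare_mulDr : right_distributive (@mul S) (@Algebra.add S)
}.

#[short(type="bareSemiringType")]
HB.structure Definition BareSemiring :=
  {S of isBareSemiring S & Algebra.BaseAddMagma S & Magma S}.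

Section Congruences.
Variable S : bareSemiringType.
Implicit Types r s : S -> S -> Prop.

Definition congruence r : Prop :=
  [/\ Equivalence r,
      forall a b c d, r a b -> r c d -> r (a + c) (b + d) &
      forall a b c d, r a b -> r c d -> r (a * c)%g (b * d)%g].

Definition nonidentity r : Prop := exists a b, r a b /\ a <> b.

(* [r] is the least non-identity congruence. *)
Definition is_monolith r : Prop :=
  [/\ congruence r, nonidentity r &
      forall s, congruence s -> nonidentity s -> forall a b, r a b -> s a b].

End Congruences.

Definition subdirectly_irreducible (S : bareSemiringType) : Prop :=
  (exists a b : S, a <> b) /\ exists r : S -> S -> Prop, is_monolith r.

Record endo (G : comInvSemigroupType) := Endo {
  endo_fun :> G -> G;
  endoD : {morph endo_fun : x y / x + y}
}.

Section Endomorphisms.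
Variable G : comInvSemigroupType.
Implicit Types (a b e x y : G) (f g : endo G).

Lemma endo_ext f g : (forall x, f x = g x) -> f = g.
Proof.
case: f g => [f fD] [g gD] /= /funext fg.
by case: _ / fg in gD *; congr Endo; exact: Prop_irrelevance.
Qed.

Lemma endo_add_subproof f g : {morph (fun x => f x + g x) : x y / x + y}.
Proof. by move=> x y /=; rewrite !endoD Algebra.addrACA. Qed.

Definition endo_add f g : endo G := Endo (endo_add_subproof f g).

Lemma endo_mul_subproof f g : {morph (fun x => f (g x)) : x y / x + y}.
Proof. by move=> x y /=; rewrite !endoD. Qed.

Definition endo_mul f g : endo G := Endo (endo_mul_subproof f g).

HB.instance Definition _ := Algebra.hasAdd.Build (endo G) endo_add.
HB.instance Definition _ := hasMul.Build (endo G) endo_mul.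

Lemma endo_addA : associative endo_add.
Proof. by move=> f g h; apply: endo_ext => x /=; rewrite Algebra.addrA. Qed.

Lemma endo_mulA : associative endo_mul.
Proof. by move=> f g h; apply: endo_ext. Qed.

Lemma endo_mulDl : left_distributive endo_mul endo_add.
Proof. by move=> f g h; apply: endo_ext. Qed.

Lemma endo_mulDr : right_distributive endo_mul endo_add.
Proof. by move=> f g h; apply: endo_ext => x /=; rewrite endoD. Qed.

HB.instance Definition _ :=
  isBareSemiring.Build (endo G) endo_addA endo_mulA endo_mulDl endo_mulDr.

Definition idempotents : set G := [set e | e + e = e].

Definition leq_q a b : Prop := a + pinv a + b = b.

Lemma lambda_subproof a : {morph (fun _ : G => a + pinv a) : x y / x + y}.
Proof. by move=> x y /=; rewrite Algebra.addrA addr_pinvK. Qed.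

Definition lambda a : endo G := Endo (lambda_subproof a).

Definition separated_by_idempotents (A : set (endo G)) : Prop :=
  (exists f g, [/\ A f, A g & f <> g]) /\
  forall f g, A f -> A g -> f <> g -> exists2 e, idempotents e & f e <> g e.

Definition RI f g : Prop := exists a, f + lambda a = g + lambda a.

Definition lower_bounded (A : set G) : Prop :=
  exists a, forall x, A x -> leq_q a x.

Definition RL f g : Prop := lower_bounded (range f) /\ lower_bounded (range g).

Definition RIL f g : Prop := RI f g /\ RL f g.

(* Only endomorphisms with lower bounded range are [RL]-related to themselves,
   so [RIL] need not be reflexive (e.g. at the identity map when [G] has no
   lower bound).  As a congruence it is understood together with the diagonal;
   this is also [RI] intersected with the reflexive closure of [RL]. *)
Definition RR : endo G -> endo G -> Prop := clos_refl (endo G) RIL.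

End Endomorphisms.

Arguments idempotents G : clear implicits.
Arguments RR G : clear implicits.

(* Main.v *)
Require Import Defs.
From Stdlib Require Import Relation_Operators.
From mathcomp Require Import all_boot.
From mathcomp Require Import boolp classical_sets.

(** Doubling [x |-> x + x] agrees with the identity on idempotents, so
    separation forces [x + x = x]: [G] is a join semilattice and [lambda a] is
    the constant map [a].  A pair [f <> g] in a congruence yields, by
    precomposing with a constant and adding, a related pair of constants
    [p < q].  The step endomorphism sending the down-set of [p] to [u] and
    everything else to [v >= u] carries it to the pair of constants [u], [v], so
    all constants are related.  Finally, if [b] is a lower bound of [f], [c] one
    of [g], and [f + a = g + a], then
    [f = f + b ~ f + a = g + a ~ g + c = g]. *)

Set Implicit Arguments.
Unset Strict Implicit.
Unset Printing Implicit Defensive.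

Import Algebra.
Local Open Scope ring_scope.

Lemma endoDE (G : comInvSemigroupType) (f g : endo G) x :
  (f + g) x = f x + g x.
Proof. by []. Qed.

Lemma endoME (G : comInvSemigroupType) (f g : endo G) x :
  (f * g)%g x = f (g x).
Proof. by []. Qed.

Lemma separated_addxx (G : comInvSemigroupType) :
  separated_by_idempotents (@setT (endo G)) -> forall x : G, x + x = x.
Proof.
move=> [_ sep] x.
have idD : {morph (fun y : G => y) : y z / y + z} by [].
have dblD : {morph (fun y : G => y + y) : y z / y + z}.
  by move=> y z; rewrite addrACA.
suff : Endo dblD = Endo idD by move=> /(congr1 (fun f : endo G => f x)).
by apply: contrapT => /(sep _ _ I I)[e /= ee]; rewrite ee.
Qed.

Section Semilattice.
Variable G : comInvSemigroupType.
Hypothesis addxx : forall x : G, x + x = x.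
Implicit Types (a b u v x y z : G) (f g h k : endo G).

(** Since addition is idempotent, [x] satisfies both inverse equations for itself, so [pinv x = x]
    by uniqueness. *)
Lemma addr_pinv x : x + pinv x = x.
Proof. by rewrite -(@pinv_unique G x x) !addxx. Qed.

Lemma lambdaE a x : lambda a x = a.
Proof. exact: addr_pinv. Qed.

Lemma leq_qE a b : leq_q a b = (a + b = b).
Proof. by rewrite /leq_q addr_pinv. Qed.

Lemma lambda_inj : injective (@lambda G).
Proof.
by move=> a b /(congr1 (fun f : endo G => f a)); rewrite !lambdaE.
Qed.

Lemma lambdaD a b : lambda a + lambda b = lambda (a + b).
Proof. by apply: endo_ext => x; rewrite endoDE !lambdaE. Qed.

Lemma mul_endo_lambda f a : (f * lambda a)%g = lambda (f a).
Proof. by apply: endo_ext => x; rewrite endoME !lambdaE. Qed.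

Lemma RI_E f g : RI f g <-> exists a, forall x, f x + a = g x + a.
Proof.
split=> -[a fga]; exists a.
  by move=> x; move/(congr1 (fun h : endo G => h x)): fga; rewrite !endoDE lambdaE.
by apply: endo_ext => x; rewrite !endoDE lambdaE.
Qed.

Lemma lower_bounded_rangeE f :
  lower_bounded (range f) <-> exists a, forall x, a + f x = f x.
Proof.
split=> -[a lba]; exists a; first by move=> x; rewrite -leq_qE; apply: lba; exists x.
by move=> _ [x _ <-]; rewrite leq_qE.
Qed.

Lemma lower_bounded_lambda a : lower_bounded (range (lambda a)).
Proof. by apply/lower_bounded_rangeE; exists a => x; rewrite lambdaE addxx. Qed.

Lemma lower_boundedDl f g :
  lower_bounded (range f) -> lower_bounded (range (f + g)).
Proof.
move=> /lower_bounded_rangeE[a lba]; apply/lower_bounded_rangeE.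
by exists a => x; rewrite endoDE addrA lba.
Qed.

Lemma lower_boundedMl f g :
  lower_bounded (range f) -> lower_bounded (range (f * g)%g).
Proof.
move=> /lower_bounded_rangeE[a lba]; apply/lower_bounded_rangeE.
by exists a => x; rewrite endoME.
Qed.

Lemma lower_boundedMr f g :
  lower_bounded (range g) -> lower_bounded (range (f * g)%g).
Proof.
move=> /lower_bounded_rangeE[a lba]; apply/lower_bounded_rangeE.
by exists (f a) => x; rewrite endoME -endoD lba.
Qed.

Lemma endo_addC f g : f + g = g + f.
Proof. by apply: endo_ext => x; rewrite !endoDE addrC. Qed.

Lemma RIL_sym f g : RIL f g -> RIL g f.
Proof. by move=> [[a fga] [lf lg]]; split=> //; exists a. Qed.

(** The witnesses add up: [f + a + b = g + a + b = g + b + a = h + b + a]. *)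
Lemma RIL_trans f g h : RIL f g -> RIL g h -> RIL f h.
Proof.
move=> [[a fga] [lf _]] [[b ghb] [_ lh]]; split=> //.
exists (a + b); rewrite -lambdaD [LHS]bare_addA fga -[LHS]bare_addA.
by rewrite (endo_addC (lambda a)) [LHS]bare_addA ghb -[LHS]bare_addA.
Qed.

Lemma RIL_addr f g h : RIL f g -> RIL (f + h) (g + h).
Proof.
move=> [/RI_E[a fga] [lf lg]]; split; last by split; apply: lower_boundedDl.
by apply/RI_E; exists a => x; rewrite !endoDE addrAC fga addrAC.
Qed.

Lemma RIL_mulr f g h : RIL f g -> RIL (f * h)%g (g * h)%g.
Proof.
move=> [/RI_E[a fga] [lf lg]]; split; last by split; apply: lower_boundedMl.
by apply/RI_E; exists a => x; rewrite !endoME.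
Qed.

Lemma RIL_mull f g h : RIL f g -> RIL (h * f)%g (h * g)%g.
Proof.
move=> [/RI_E[a fga] [lf lg]]; split; last by split; apply: lower_boundedMr.
(* Additivity of [h] carries the witness [a] of [RI f g] to [h a]. *)
by apply/RI_E; exists (h a) => x; rewrite !endoME -!endoD fga.
Qed.

Lemma RR_trans f g h : RR G f g -> RR G g h -> RR G f h.
Proof.
case=> [g1 fg|//]; case=> [h1 gh|]; apply: r_step => //.
exact: RIL_trans fg gh.
Qed.

Lemma RR_congruence : congruence (RR G).
Proof.
split.
- split=> [f|f _ [g fg|]|f g h]; [exact: r_refl| |exact: r_refl|exact: RR_trans].
  exact/r_step/RIL_sym.
(* One argument changes at a time. Commutativity reduces the second change to the first, whereas
   composition needs a lemma for each side. *)
- move=> f g h k fg hk; apply: (@RR_trans _ (g + h)).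
    by case: fg => [g1 fg|]; [exact/r_step/RIL_addr|exact: r_refl].
  rewrite !(endo_addC g).
  by case: hk => [k1 hk|]; [exact/r_step/RIL_addr|exact: r_refl].
- move=> f g h k fg hk; apply: (@RR_trans _ (g * h)%g).
    by case: fg => [g1 fg|]; [exact/r_step/RIL_mulr|exact: r_refl].
  by case: hk => [k1 hk|]; [exact/r_step/RIL_mull|exact: r_refl].
Qed.

Lemma RR_lambda a b : RR G (lambda a) (lambda b).
Proof.
apply: r_step; split; last by split; apply: lower_bounded_lambda.
(* The join [a + b] absorbs both constants. *)
apply/RI_E; exists (a + b) => x.
by rewrite !lambdaE addrA addxx addrCA addxx.
Qed.

Section Step.
Variables (p u v : G).
Hypothesis uv : u + v = v.

Let step x := if `[< x + p = p >] then u else v.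

(** The down-set of [p] is an ideal: a join lies below [p] exactly when both terms do. Hence the map
    respects joins into the chain [u <= v]. *)
Lemma step_additive : {morph step : x y / x + y}.
Proof.
move=> x y; rewrite /step.
have -> : `[< x + y + p = p >] = `[< x + p = p >] && `[< y + p = p >].
  apply/asboolP/andP => [xyp|[/asboolP xp /asboolP yp]]; last first.
    by rewrite -addrA yp.
  (* Once [p] is written as [x + y + p], it absorbs [x] and [y]. *)
  by split; apply/asboolP; rewrite -xyp; [rewrite !addrA|rewrite -addrA addrCA (addrA y)];
    rewrite addxx.
by case: asboolP => _; case: asboolP => _ /=; rewrite ?addxx ?uv // addrC uv.
Qed.

Definition step_endo : endo G := Endo step_additive.

Lemma step_endo_le x : x + p = p -> step_endo x = u.
Proof. by move=> xp; rewrite /= /step asboolT. Qed.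

Lemma step_endo_nle x : x + p <> p -> step_endo x = v.
Proof. by move=> xp; rewrite /= /step asboolF. Qed.

End Step.

Section Least.
Variable s : endo G -> endo G -> Prop.
Hypothesis s_cong : congruence s.

Let s_refl f : s f f.
Proof. by case: s_cong => -[]. Qed.

Let s_sym f g : s f g -> s g f.
Proof. by case: s_cong => -[_ sym _] _ _; apply: sym. Qed.

Let s_trans f g h : s f g -> s g h -> s f h.
Proof. by case: s_cong => -[_ _ trans] _ _; apply: trans. Qed.

Let s_add f g h : s f g -> s (h + f) (h + g).
Proof. by case: s_cong => _ sD _; apply: sD. Qed.

Let s_mulr f g h : s f g -> s (f * h)%g (g * h)%g.
Proof. by case: s_cong => _ _ sM fg; apply: sM. Qed.

Let s_mull f g h : s f g -> s (h * f)%g (h * g)%g.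
Proof. by case: s_cong => _ _ sM; apply: sM. Qed.

Lemma congruence_strict_lambda :
  nonidentity s ->
  exists p q, [/\ p + q = q, p <> q & s (lambda p) (lambda q)].
Proof.
move=> [f [g [sfg fg]]].
have [x fgx] : exists x, f x <> g x.
  by apply: contrapT => /forallNP fgE; apply: fg; apply: endo_ext => x; apply: contrapT.
(* Composing with [lambda x] on the right turns [f] and [g] into the distinct constants [f x] and
   [g x]. *)
have := s_mulr (lambda x) sfg; rewrite !mul_endo_lambda.
move: (f x) (g x) fgx => c d cd scd.
(* Either [d] is strictly below [c], or adding [lambda c] to the pair gives [c] strictly below
   [c + d]. *)
have [cdc|cdc] := pselect (c = c + d).
  exists d, c; split; [by rewrite addrC -cdc|exact/nesym|exact: s_sym].
exists c, (c + d); split=> //; first by rewrite addrA addxx.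
by have := s_add (lambda c) scd; rewrite !lambdaD addxx.
Qed.

Lemma congruence_lambda a b : nonidentity s -> s (lambda a) (lambda b).
Proof.
move=> /congruence_strict_lambda[p [q [pq pNq spq]]].
have le u v : u + v = v -> s (lambda u) (lambda v).
  move=> uv; have := s_mull (step_endo p uv) spq; rewrite !mul_endo_lambda.
  (* [q] is outside the down-set of [p]: [q + p = q], which differs from [p]. *)
  rewrite step_endo_le// step_endo_nle// addrC pq.
  exact: nesym.
(* Arbitrary [a] and [b] need not be comparable, but both lie below [a + b]. *)
apply: (@s_trans _ (lambda (a + b))); first by apply: le; rewrite addrA addxx.
by apply: s_sym; apply: le; rewrite addrCA addxx.
Qed.

(** A lower bound [b] gives [f = f + lambda b], and [lambda b] may be exchanged for any constant. *)
Lemma congruence_lower_bounded f a :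
  nonidentity s -> lower_bounded (range f) -> s f (f + lambda a).
Proof.
move=> ns /lower_bounded_rangeE[b lb].
have {1}-> : f = f + lambda b.
  by apply: endo_ext => x; rewrite endoDE lambdaE addrC lb.
exact/s_add/congruence_lambda.
Qed.

Lemma RR_least f g : nonidentity s -> RR G f g -> s f g.
Proof.
move=> ns [k [[a fka] [lf lk]]|]; last exact: s_refl.
apply: (s_trans (congruence_lower_bounded a ns lf)); rewrite fka.
exact/s_sym/congruence_lower_bounded.
Qed.

End Least.
End Semilattice.

Theorem corollary2p13 (G : comInvSemigroupType)
  (two_idempotents : exists e f : G, idempotents G e /\ idempotents G f /\ e <> f)
  (End_separated : separated_by_idempotents (@setT (endo G))) :
  subdirectly_irreducible (endo G) /\ is_monolith (RR G).
Proof.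
have addxx := separated_addxx End_separated.
have [e [f [_ [_ ef]]]] := two_idempotents.
(* This pair of constants shows both that [endo G] has two elements and that [RR G] is not the
   identity. *)
have lef : lambda e <> lambda f by move/(lambda_inj addxx).
have RRm : is_monolith (RR G).
  split; first exact: RR_congruence.
    by exists (lambda e), (lambda f); split=> //; apply: RR_lambda.
  by move=> s sc ns g h; apply: RR_least.
by split=> //; split; [exists (lambda e), (lambda f)|exists (RR G)].
Qed.
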